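(* Let $\Gamma^1=(G,\sigma_1,\mu_1)$ be a $\gamma_1$-regular signed graph on $n_1$ vertices and $m_1$ edges, let $\theta$ be any $r$-orientation of the edges of $\Gamma^1$, and let $\Gamma^2=(H,\sigma_2,\mu_2)$ be an arbitrary signed graph on $n_2$ vertices. Let $\lambda_1(\Gamma^1),\dots,\lambda_{n_1}(\Gamma^1)$ be the eigenvalues of $A(\Gamma^1)$. Then $$f_{A((\Gamma^1\boxminus\Gamma^2)_\theta)}(\lambda)=\lambda^{m_1-n_1}\big(f_{A(\Gamma^2)}(\lambda)\big)^{m_1}\prod_{j=1}^{n_1}\Big(\lambda^2-\big(1+\lambda\,\Sigma_{A(\Gamma^2)}(\lambda)\big)\big(\lambda_j(\Gamma^1)+\gamma_1\big)\Big).$$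
   Context: A signed graph $\Gamma=(G,\sigma,\mu)$ has a finite simple graph $G$ with vertices $v_1,\dots,v_n$, signature $\sigma:E(G)\to\{\pm1\}$ and marking $\mu:V(G)\to\{\pm1\}$; $\mu(\Gamma)=(\mu(v_1),\dots,\mu(v_n))^T$. $A(\Gamma)$ has $(i,j)$ entry $\sigma(v_iv_j)$ if $v_i\sim v_j$ and $0$ otherwise. $\gamma$-regular means all degrees equal $\gamma$. $f_M(\lambda)=\det(\lambda I-M)$. The signed $N$-coronal is the rational function $\Sigma_N(X)=\mu(\Gamma)^T(XI_n-N)^{-1}\mu(\Gamma)$. An $r$-orientation of $(G,\sigma)$ is a map $\theta:V(G)\times E(G)\to\{-1,0,1\}$ with $\theta(w,uv)=0$ for $w\notin\{u,v\}$, $\theta(u,uv)\in\{\pm1\}$ at endpoints, and $\theta(u,uv)\theta(v,uv)=\sigma(uv)$. The subdivision graph $S(\Gamma^1_\theta)$ is obtained by inserting a new vertex $v_e$ into each edge $e$ of $\Gamma^1$, the edge $v_iv_e$ having sign $\theta(v_i,e)$. With $E(\Gamma^1)=\{e_1,\dots,e_{m_1}\}$, the subdivision edge neighbourhood corona $(\Gamma^1\boxminus\Gamma^2)_\theta$ is obtained from $S(\Gamma^1_\theta)$ and $m_1$ disjoint copies of $\Gamma^2$ by joining, for each $t$, both endpoints $v$ of $e_t$ to every vertex $u$ of the $t$-th copy, with sign $\theta(v,e_t)\mu_2(u)$, where $\mu_2(u)$ is the marking of the corresponding vertex of $\Gamma^2$. *)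

(* Defs.v *)
From HB Require Import structures.
From mathcomp Require Import all_boot all_order all_algebra.

Set Implicit Arguments.
Unset Strict Implicit.
Unset Printing Implicit Defensive.

Import Order.TTheory GRing.Theory Num.Theory.
Local Open Scope ring_scope.

Notation "x %:F" := (@FracField.tofrac _ x) : ring_scope.

Definition is_sign (x : int) : Prop := x = 1 \/ x = -1.

(* A pair (G, sigma). The signature of the edge uv is given by a function of
   the two endpoints that is symmetric on adjacent pairs; its values on
   non-adjacent pairs carry no information. *)
Record signed_graph := SignedGraph {
  vertex :> finType;
  adj : rel vertex;
  adj_sym : symmetric adj;
  adj_irr : irreflexive adj;
  sig : vertex -> vertex -> int;
  sig_sym : forall u v, adj u v -> sig u v = sig v u;
  sig_sign : forall u v, adj u v -> is_sign (sig u v)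
}.

(* A triple (G, sigma, mu). *)
Record marked_graph := MarkedGraph {
  mgraph :> signed_graph;
  marking : mgraph -> int;
  marking_sign : forall v, is_sign (marking v)
}.

Definition is_edge (G : signed_graph) (e : {set G}) : bool :=
  [exists u, exists v, adj u v && (e == [set u; v])].

Definition edge (G : signed_graph) : finType := {e : {set G} | is_edge e}.

Definition ends (G : signed_graph) (e : edge G) : {set G} := sval e.

Definition regular (G : signed_graph) (k : nat) : Prop :=
  forall v : G, #|[set u | adj v u]| = k.

Record r_orientation (G : signed_graph) := ROrientation {
  theta :> G -> edge G -> int;
  theta_out : forall w (e : edge G), w \notin ends e -> theta w e = 0;
  theta_end : forall u (e : edge G), u \in ends e -> is_sign (theta u e);
  theta_mul : forall u v (e : edge G), adj u v -> ends e = [set u; v] ->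
    theta u e * theta v e = sig u v
}.

Section Subdivision.
Variables (G : signed_graph) (th : r_orientation G).

(* [inl v] is an old vertex, [inr e] the vertex inserted into the edge e. *)
Definition sub_vertex : finType := (G + edge G)%type.

Definition sub_adj (x y : sub_vertex) : bool :=
  match x, y with
  | inl v, inr e | inr e, inl v => v \in ends e
  | _, _ => false
  end.

Definition sub_sig (x y : sub_vertex) : int :=
  match x, y with
  | inl v, inr e | inr e, inl v => th v e
  | _, _ => 0
  end.

Lemma sub_adj_sym : symmetric sub_adj.
Proof. by case=> [?|?] [?|?]. Qed.

Lemma sub_adj_irr : irreflexive sub_adj.
Proof. by case. Qed.

Lemma sub_sig_sym x y : sub_adj x y -> sub_sig x y = sub_sig y x.
Proof. by case: x; case: y. Qed.

Lemma sub_sig_sign x y : sub_adj x y -> is_sign (sub_sig x y).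
Proof. by case: x; case: y => //= ? ?; apply: theta_end. Qed.

Definition subdivision : signed_graph :=
  SignedGraph sub_adj_sym sub_adj_irr sub_sig_sym sub_sig_sign.

End Subdivision.

Section Corona.
Variables (G1 : signed_graph) (G2 : marked_graph) (th : r_orientation G1).

(* [inl x] is a vertex of the subdivision graph, [inr (e, u)] the vertex u of
   the copy of G2 attached to the edge e. *)
Definition cor_vertex : finType := (subdivision th + edge G1 * G2)%type.

Definition cor_adj (x y : cor_vertex) : bool :=
  match x, y with
  | inl a, inl b => adj a b
  | inl (inl v), inr (e, _) | inr (e, _), inl (inl v) => v \in ends e
  | inr (e, u), inr (e', u') => (e == e') && adj u u'
  | _, _ => false
  end.

Definition cor_sig (x y : cor_vertex) : int :=
  match x, y with
  | inl a, inl b => sig a b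
  | inl (inl v), inr (e, u) | inr (e, u), inl (inl v) => th v e * marking u
  | inr (_, u), inr (_, u') => sig u u'
  | _, _ => 0
  end.

Lemma cor_adj_sym : symmetric cor_adj.
Proof.
case=> [[a|a]|[e u]] [[b|b]|[e' u']] //=.
by rewrite eq_sym adj_sym.
Qed.

Lemma cor_adj_irr : irreflexive cor_adj.
Proof. by case=> [[a|a]|[e u]] //=; rewrite adj_irr andbF. Qed.

Lemma cor_sig_sym x y : cor_adj x y -> cor_sig x y = cor_sig y x.
Proof.
case: x y => [[a|a]|[e u]] [[b|b]|[e' u']] //=.
by case/andP=> _; apply: sig_sym.
Qed.

Lemma is_signM x y : is_sign x -> is_sign y -> is_sign (x * y).
Proof. by move=> [->|->] [->|->]; [left|right|right|left]. Qed.

Lemma cor_sig_sign x y : cor_adj x y -> is_sign (cor_sig x y).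
Proof.
case: x y => [[a|a]|[e u]] [[b|b]|[e' u']] //=; try exact: theta_end.
- by move=> ae; apply: is_signM; [exact: theta_end | exact: marking_sign].
- by move=> be; apply: is_signM; [exact: theta_end | exact: marking_sign].
- by case/andP=> _; apply: sig_sign.
Qed.

(* Only (G, sigma) is produced: no marking of the corona is needed for its
   adjacency matrix. *)
Definition sub_edge_nbhd_corona : signed_graph :=
  SignedGraph cor_adj_sym cor_adj_irr cor_sig_sym cor_sig_sign.

End Corona.

Section Matrices.
Variable R : fieldType.

Definition adj_mx (G : signed_graph) : 'M[R]_#|G| :=
  \matrix_(i, j) if adj (enum_val i) (enum_val j)
                 then (sig (enum_val i) (enum_val j))%:~R else 0.

Definition marking_vec (K : fieldType) (G : marked_graph) : 'cV[K]_#|G| :=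
  \col_i (marking (enum_val i))%:~R.

(* The inverse is taken over the field of rational functions, where
   X I - N is always invertible. *)
Definition coronal (G : marked_graph) (N : 'M[R]_#|G|) :
    {fraction {poly R}} :=
  let mu := marking_vec {fraction {poly R}} G in
  (mu^T *m invmx (('X%:F)%:M - map_mx (fun a : R => (a%:P)%:F) N) *m mu)
    ord0 ord0.

End Matrices.

(* Main.v *)
Require Import Defs.
From mathcomp Require Import all_boot all_order all_algebra all_fingroup.
From mathcomp Require Import mxtens ring.
Import Order.TTheory GRing.Theory Num.Theory.
Local Open Scope ring_scope.

(** Order the vertices of the corona as old vertices, subdivision vertices and
    copies of [G2].  With [T] the incidence matrix of the orientation and [mu]
    the marking of [G2], the matrix [x I - A] becomes
      [[x I, -T, -(T (x) mu^T)], [-T^T, x I, 0], [-(T^T (x) mu), 0, I (x) (x I - A2)]],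
    where [(x)] is the Kronecker product.  The lower right block is block
    diagonal, and its Schur complement is [x I - (1/x + s) T T^T] with [s] the
    coronal of [G2]: the mixed-product rule gives
      (T (x) mu^T) (I (x) B^-1) (T^T (x) mu) = (mu^T B^-1 mu) T T^T.
    The definition of an r-orientation and regularity of [G1] give
    [T T^T = A1 + gamma1 I], so the remaining determinant is a product over the
    eigenvalues of [A1]. *)

Set Implicit Arguments.
Unset Strict Implicit.

(** * Determinants of block and Kronecker matrices *)

(** Two enumerations of [T] differ by a permutation of rows and columns alike, so its sign occurs
    twice and cancels. This frees the determinant from the order given by [enum_val]. *)
Lemma det_reindex (K : comNzRingType) (T : finType) (F : T -> T -> K) n
    (h : 'I_n -> T) :
  bijective h ->
  \det (\matrix_(i, j) F (enum_val i) (enum_val j) : 'M_#|T|)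
    = \det (\matrix_(i, j) F (h i) (h j)).
Proof.
move=> bh; have := bij_eq_card bh; rewrite card_ord => en; subst n.
have inj_s : injective (enum_rank \o h).
  by apply: inj_comp; [exact: enum_rank_inj | exact: bij_inj].
pose s := perm inj_s.
set M := (X in \det X = _); have -> : (\matrix_(i, j) F (h i) (h j))
    = row_perm s (col_perm s M).
  by apply/matrixP=> i j; rewrite !mxE !permE /= !enum_rankK.
rewrite row_permE col_permE !det_mulmx !det_perm odd_permV mulrCA.
by rewrite -signr_addb addbb mulr1.
Qed.

(** A block column operation with the unipotent matrix [L] clears [C] and leaves a block upper
    triangular matrix. *)
Lemma det_block_schur (K : comNzRingType) n m (A : 'M[K]_n) (B : 'M_(n, m)) C
    (D D' : 'M_m) :
  D *m D' = 1%:M ->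
  \det (block_mx A B C D) = \det D * \det (A - B *m D' *m C).
Proof.
move=> DD'; pose L := block_mx (1%:M : 'M[K]_n) 0 (- (D' *m C)) (1%:M : 'M_m).
have detL : \det L = 1 by rewrite det_lblock !det1 mulr1.
rewrite -[LHS]mulr1 -detL -det_mulmx mulmx_block !mulmx1 !mulmx0 !add0r.
by rewrite !mulmxN !mulmxA DD' mul1mx subrr det_ublock mulrC.
Qed.

Lemma tens1mx1 (K : comNzRingType) m n :
  (1%:M : 'M[K]_m) *t (1%:M : 'M_n) = 1%:M.
Proof.
apply/matrixP=> i j; case: (mxtens_indexP i) => i1 i2.
case: (mxtens_indexP j) => j1 j2; rewrite tensmxE !mxE -natrM mulnb.
by rewrite (can_eq (@mxtens_indexK m n)).
Qed.

Lemma det_tens1mx (K : comNzRingType) m n (B : 'M[K]_n) :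
  \det ((1%:M : 'M_m) *t B) = \det B ^+ m.
Proof.
elim: m => [|m IHm]; first by rewrite det_mx00 expr0.
rewrite (_ : (1%:M : 'M_m.+1) *t B
   = block_mx B 0 0 ((1%:M : 'M_m) *t B) :> 'M_(n + m * n)).
  by rewrite det_ublock IHm exprS.
(* The pair [(k, l)] has Kronecker index [k * n + l], so the first [n] indices form the block to
   split off and the others are shifted by [n]. *)
have lindex (k : 'I_n) : lshift (m * n) k = mxtens_index (ord0 : 'I_m.+1, k).
  exact: val_inj.
have rindex (k : 'I_m) (l : 'I_n) :
    rshift n (mxtens_index (k, l)) = mxtens_index (lift ord0 k : 'I_m.+1, l).
  by apply: val_inj; rewrite /= addnA.
apply/matrixP=> i j; case: (split_ordP i) => i' ->; case: (split_ordP j) => j' ->.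
- rewrite block_mxEul !lindex; apply: etrans (tensmxE _ _ _ _ _ _) _.
  by rewrite mxE mul1r.
- case: (mxtens_indexP j') => j1 j2; rewrite block_mxEur lindex rindex.
  by apply: etrans (tensmxE _ _ _ _ _ _) _; rewrite !mxE mul0r.
- case: (mxtens_indexP i') => i1 i2; rewrite block_mxEdl lindex rindex.
  by apply: etrans (tensmxE _ _ _ _ _ _) _; rewrite !mxE mul0r.
- case: (mxtens_indexP i') => i1 i2; case: (mxtens_indexP j') => j1 j2.
  rewrite block_mxEdr !rindex tensmxE; apply: etrans (tensmxE _ _ _ _ _ _) _.
  by rewrite !mxE (inj_eq lift_inj).
Qed.

(** Up to the cast from [n * 1] to [n], [P] is the Kronecker product of [T] and [mu^T]; the
    mixed-product rule then leaves a [1 x 1] second factor, which acts as a scalar. *)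
Lemma tens1mx_congr (K : comNzRingType) n m p (T : 'M[K]_(n, m)) (mu : 'cV_p)
    (B : 'M_p) :
  let P := \matrix_(i < n, k < m * p)
             (T i (mxtens_unindex k).1 * mu (mxtens_unindex k).2 ord0) in
  P *m (1%:M *t B) *m P^T = (mu^T *m B *m mu) ord0 ord0 *: (T *m T^T).
Proof.
move=> P; have -> : P = castmx (muln1 n, erefl) (T *t mu^T).
  apply/matrixP=> i k; rewrite castmxE !mxE cast_ord_id.
  by congr (T _ _ * mu _ _); apply: val_inj; rewrite /= ?divn1 ?modn1.
rewrite trmx_cast trmx_tens trmxK /= -[1%:M *t B](castmx_id (erefl, erefl)).
rewrite -(castmx_mul (muln1 n) erefl) -castmx_mul !tensmx_mul mulmx1.
by rewrite {1}[mu^T *m B *m mu]mx11_scalar tens_mx_scalar castmx_comp castmx_id.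
Qed.

Lemma det_corona_block (K : fieldType) n m p (x : K) (T : 'M[K]_(n, m))
    (mu : 'cV_p) (B : 'M_p) :
  let P := \matrix_(i < n, k < m * p)
             (T i (mxtens_unindex k).1 * mu (mxtens_unindex k).2 ord0) in
  x != 0 -> B \in unitmx ->
  \det (block_mx x%:M (row_mx (- T) (- P)) (col_mx (- T^T) (- P^T))
         (block_mx x%:M 0 0 (1%:M *t B)))
  = x ^+ m * \det B ^+ m
    * \det (x%:M - (x^-1 + (mu^T *m invmx B *m mu) ord0 ord0) *: (T *m T^T)).
Proof.
move=> P x0 Bu.
(* The lower right block is block diagonal and is inverted blockwise. *)
rewrite (@det_block_schur _ _ _ _ _ _ _
  (block_mx (x^-1)%:M 0 0 (1%:M *t invmx B))); last first.
  rewrite mulmx_block !mulmx0 !mul0mx !addr0 add0r -scalar_mxM divff //.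
  by rewrite tensmx_mul mulmx1 mulmxV // tens1mx1 -scalar_mx_block.
rewrite det_ublock det_scalar det_tens1mx; congr (_ * \det (_ - _)).
rewrite mul_row_block mul_row_col !mulmx0 addr0 add0r !mulNmx !mulmxN !opprK.
by rewrite mul_mx_scalar -scalemxAl tens1mx_congr scalerDl.
Qed.

(** For nonzero [c] this is the characteristic polynomial evaluated at [a / c], rescaled by
    [c ^+ n]; [c = 0] is treated apart. *)
Lemma det_scalar_subZ (K : fieldType) n (A : 'M[K]_n) (lam : 'I_n -> K) (a c : K) :
  char_poly A = \prod_(j < n) ('X - (lam j)%:P) ->
  \det (a%:M - c *: A) = \prod_(j < n) (a - c * lam j).
Proof.
move=> hA; have detB b : \det (b%:M - A) = \prod_(j < n) (b - lam j).
  have := congr1 (horner^~ b) hA; rewrite horner_prod.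
  under eq_bigr do rewrite hornerXsubC.
  move=> <-; rewrite /char_poly -[LHS]/(\det _) -horner_evalE -det_map_mx.
  congr (\det _); apply/matrixP=> i j.
  by rewrite !mxE /= /horner_eval !hornerE hornerMn hornerX.
have [->|c0] := eqVneq c 0.
  under eq_bigr do rewrite mul0r subr0.
  by rewrite scale0r subr0 det_scalar prodr_const card_ord.
have -> : a%:M - c *: A = c *: ((a / c)%:M - A).
  by rewrite scalerBr scale_scalar_mx mulrC divfK.
rewrite detZ detB -{1}(card_ord n) -prodr_const -big_split /=.
by apply: eq_bigr => j _; rewrite mulrBr mulrC divfK.
Qed.

(** * The incidence matrix of an r-orientation *)

Section Incidence.
Variables (G : signed_graph) (th : r_orientation G).

Lemma edge_endsP (e : edge G) :
  exists u, exists2 v, adj u v & ends e = [set u; v].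
Proof.
by case: e => e /= /existsP[u /existsP[v /andP[uv /eqP ->]]]; exists u, v.
Qed.

Lemma edge_of_adj (u v : G) : adj u v -> exists e : edge G, ends e = [set u; v].
Proof.
move=> uv; have He : is_edge [set u; v].
  by apply/existsP; exists u; apply/existsP; exists v; rewrite uv eqxx.
by exists (exist (fun e : {set G} => is_edge e) _ He).
Qed.

Lemma ends_adj (e : edge G) (u v : G) :
  u != v -> u \in ends e -> v \in ends e -> adj u v /\ ends e = [set u; v].
Proof.
have [a [b ab ->]] := edge_endsP e; move=> uv; rewrite !inE.
case/orP=> /eqP eu /orP[] /eqP ev; subst u v; rewrite ?eqxx // in uv *.
by rewrite adj_sym setUC.
Qed.

(** The map sending a neighbour [v] of [u] to [[set u; v]] is a bijection onto the edges at [u]. *)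
Lemma card_incident_edges (u : G) :
  #|[set e : edge G | u \in ends e]| = #|[set v | adj u v]|.
Proof.
rewrite -(card_imset _ val_inj) -[RHS](@card_in_imset _ _ (fun v => [set u; v])).
  apply: eq_card => s; apply/imsetP/imsetP => [[e]|[v]]; rewrite inE.
    move=> ue ->; have [a [b ab eab]] := edge_endsP e.
    move: ue; rewrite eab !inE => /orP[] /eqP eu; subst u.
      by exists b; rewrite ?inE.
    by exists a; rewrite ?inE 1?adj_sym // setUC.
  move=> uv ->; have [e he] := edge_of_adj uv.
  by exists e; rewrite ?inE ?he ?set21.
move=> v w; rewrite !inE => uv uw /setP/(_ v).
rewrite !inE eqxx orbT; case: eqP => [vu|_] /esym/eqP //.
by rewrite vu adj_irr in uv.
Qed.

(** This is the entry of [T T^T] at [(u, v)]. On the diagonal each edge at [u] contributes a squared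
    sign; off it only the edge joining [u] and [v], if any, contributes. *)
Lemma sum_theta k (u v : G) : regular G k ->
  \sum_(e : edge G) th u e * th v e
  = (if adj u v then sig u v else 0) + (k%:R : int) *+ (u == v).
Proof.
move=> reg; have [<-|uv] := eqVneq u v.
  rewrite adj_irr add0r mulr1n -(reg u) -card_incident_edges.
  rewrite (bigID (fun e : edge G => u \in ends e)) /= [X in _ + X]big1 ?addr0.
    rewrite -sum1_card natr_sum; apply: eq_big => [e|e ue]; first by rewrite inE.
    by case: (theta_end th ue) => ->.
  by move=> e ue; rewrite theta_out // mul0r.
rewrite mulr0n addr0; case: ifP => [auv|/negP nauv].
  have [e he] := edge_of_adj auv.
  rewrite (bigD1 e) //= (theta_mul th auv he) big1 ?addr0 // => f fe.
  have [uf|uf] := boolP (u \in ends f); last by rewrite theta_out // mul0r.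
  have [vf|vf] := boolP (v \in ends f); last by rewrite [X in _ * X]theta_out // mulr0.
  have [_ hf] := ends_adj uv uf vf.
  by case/eqP: fe; apply: val_inj; rewrite /= -[LHS]/(ends f) hf -he.
rewrite big1 // => f _.
have [uf|uf] := boolP (u \in ends f); last by rewrite theta_out // mul0r.
have [vf|vf] := boolP (v \in ends f); last by rewrite [X in _ * X]theta_out // mulr0.
by have [] := ends_adj uv uf vf.
Qed.

Definition theta_mx (K : fieldType) : 'M[K]_(#|G|, #|edge G|) :=
  \matrix_(i, e) (th (enum_val i) (enum_val e))%:~R.

Lemma theta_mxMtr (K : fieldType) k : regular G k ->
  theta_mx K *m (theta_mx K)^T = adj_mx K G + (k%:R)%:M.
Proof.
move=> reg; apply/matrixP => i j; rewrite !mxE.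
transitivity ((\sum_(e : edge G) th (enum_val i) e * th (enum_val j) e)%:~R : K).
  rewrite rmorph_sum /= (reindex (@enum_val _ (edge G))) /=; last first.
    exact/onW_bij/enum_val_bij.
  by apply: eq_bigr => e _; rewrite !mxE intrM.
rewrite (sum_theta _ _ reg) intrD rmorphMn /= rmorph_nat (inj_eq enum_val_inj).
by case: ifP.
Qed.

End Incidence.

(** * The determinant of the corona over a field *)

Section CoronaDet.
Variables (G1 : signed_graph) (G2 : marked_graph) (th : r_orientation G1).

Let n := #|G1|.
Let m := #|edge G1|.
Let p := #|G2|.

(** Copy vertices are numbered by Kronecker indices, so that the blocks of the adjacency matrix are
    literal Kronecker products. *)
Definition corona_index (i : 'I_(n + (m + m * p))) : cor_vertex G2 th :=
  match split i with
  | inl v => inl (inl (enum_val v))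
  | inr j =>
    match split j with
    | inl e => inl (inr (enum_val e))
    | inr k => let: (e, u) := mxtens_unindex k in inr (enum_val e, enum_val u)
    end
  end.

Lemma corona_index_bij : bijective corona_index.
Proof.
exists (fun x : cor_vertex G2 th => match x with
  | inl (inl v) => lshift _ (enum_rank v)
  | inl (inr e) => rshift _ (lshift _ (enum_rank e))
  | inr (e, u) =>
      rshift _ (rshift _ (mxtens_index (enum_rank e, enum_rank u)))
  end).
- move=> i; rewrite /corona_index; case: split_ordP => [v ->|j ->].
    by rewrite enum_valK.
  case: split_ordP => [e ->|k ->]; first by rewrite enum_valK.
  by case: (mxtens_indexP k) => e u; rewrite mxtens_indexK !enum_valK.
- case=> [[v|e]|[e u]]; rewrite /corona_index.
  + by rewrite (unsplitK (inl _)) enum_rankK.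
  + by rewrite (unsplitK (inr _)) (unsplitK (inl _)) enum_rankK.
  + by rewrite !(unsplitK (inr _)) mxtens_indexK !enum_rankK.
Qed.

Lemma det_corona (K : fieldType) (x : K) (k : nat) :
  regular G1 k -> x != 0 -> x%:M - adj_mx K G2 \in unitmx ->
  let mu := marking_vec K G2 in
  \det (x%:M - adj_mx K (sub_edge_nbhd_corona G2 th))
  = x ^+ m * \det (x%:M - adj_mx K G2) ^+ m
    * \det (x%:M - (x^-1 + (mu^T *m invmx (x%:M - adj_mx K G2) *m mu) ord0 ord0)
                     *: (adj_mx K G1 + (k%:R)%:M)).
Proof.
move=> reg x0 Bu mu; rewrite -(theta_mxMtr th K reg) -det_corona_block //.
pose F (a b : sub_edge_nbhd_corona G2 th) : K :=
  x *+ (a == b) - (if adj a b then (sig a b)%:~R else 0).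
transitivity (\det (\matrix_(i, j) F (enum_val i) (enum_val j)
    : 'M_#|sub_edge_nbhd_corona G2 th|)).
  congr (\det _); apply/matrixP=> i j.
  by rewrite !mxE /F (inj_eq enum_val_inj).
rewrite (det_reindex F corona_index_bij); congr (\det _).
have thE (v : G1) (e : edge G1) :
    (if v \in ends e then (th v e)%:~R else 0) = (th v e)%:~R :> K.
  by case: ifPn => // /theta_out ->.
have thME (v : G1) (e : edge G1) (u : G2) :
    (if v \in ends e then (th v e * marking u)%:~R else 0)
    = (th v e)%:~R * (marking u)%:~R :> K.
  by rewrite intrM; case: ifPn => // /theta_out ->; rewrite mul0r.
apply/matrixP=> i j; rewrite mxE /F /corona_index.
case: (split_ordP i) => [v ->|i' ->]; case: (split_ordP j) => [w ->|j' ->].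
- by rewrite block_mxEul mxE /= subr0 !(inj_eq inl_inj)
    (inj_eq enum_val_inj).
- rewrite block_mxEur; case: (split_ordP j') => [e ->|k' ->].
    by rewrite row_mxEl !mxE sub0r /= thE.
  case: (mxtens_indexP k') => e u; rewrite row_mxEr !mxE mxtens_indexK /=.
  by rewrite sub0r thME.
- rewrite block_mxEdl; case: (split_ordP i') => [e ->|k' ->].
    by rewrite col_mxEu !mxE sub0r /= thE.
  case: (mxtens_indexP k') => e u; rewrite col_mxEd !mxE mxtens_indexK /=.
  by rewrite sub0r thME.
- rewrite block_mxEdr; case: (split_ordP i') => [e ->|k' ->];
    case: (split_ordP j') => [f ->|l' ->].
  + by rewrite block_mxEul mxE /= subr0 (inj_eq inl_inj)
      (inj_eq inr_inj) (inj_eq enum_val_inj).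
  + by rewrite block_mxEur mxE; case: mxtens_unindex => ? ?; rewrite subr0.
  + by rewrite block_mxEdl mxE; case: mxtens_unindex => ? ?; rewrite subr0.
  case: (mxtens_indexP k') => e u; case: (mxtens_indexP l') => f w.
  rewrite block_mxEdr tensmxE !mxE !mxtens_indexK /= (inj_eq inr_inj).
  rewrite xpair_eqE !(inj_eq enum_val_inj).
  by case: (e == f); rewrite /= ?mul1r // mul0r subr0.
Qed.

Lemma det_corona_eigen (K : fieldType) (x : K) (k : nat) (lam : 'I_n -> K) :
  regular G1 k -> x != 0 -> x%:M - adj_mx K G2 \in unitmx ->
  char_poly (adj_mx K G1) = \prod_j ('X - (lam j)%:P) ->
  let mu := marking_vec K G2 in
  let s := (mu^T *m invmx (x%:M - adj_mx K G2) *m mu) ord0 ord0 in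
  \det (x%:M - adj_mx K (sub_edge_nbhd_corona G2 th))
  = x ^ (m%:Z - n%:Z) * \det (x%:M - adj_mx K G2) ^+ m
    * \prod_j (x ^+ 2 - (1 + x * s) * (lam j + k%:R)).
Proof.
move=> reg x0 Bu hlam mu s; rewrite (det_corona reg x0 Bu) -/mu -/s.
(* The multiple of the identity coming from regularity joins the scalar part, leaving only
   [adj_mx K G1] to be split by its eigenvalues. *)
have -> : x%:M - (x^-1 + s) *: (adj_mx K G1 + (k%:R)%:M)
    = (x - (x^-1 + s) * k%:R)%:M - (x^-1 + s) *: adj_mx K G1.
  by rewrite scalerDr scale_scalar_mx [in RHS]raddfB opprD addrA addrAC.
rewrite (det_scalar_subZ _ _ hlam) expfzDr // -exprnN -exprVn -exprnP.
rewrite -[RHS]mulrA -[RHS]mulrACA; congr (_ * _).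
(* One [x^-1] goes to each of the [n] eigenvalue factors, where it clears the denominator of
   [x^-1 + s]. *)
have -> : x^-1 ^+ n = \prod_(j < n) x^-1 by rewrite prodr_const card_ord.
by rewrite -big_split /=; apply: eq_bigr => j _; field.
Qed.

End CoronaDet.

(** * Specialisation to the field of rational functions *)

Unset Implicit Arguments.
Set Strict Implicit.

Theorem theorem5p13 (R : rcfType) (G1 G2 : marked_graph)
    (n1 m1 n2 gamma1 : nat)
    (hn1 : #|G1| = n1) (hm1 : #|edge G1| = m1) (hn2 : #|G2| = n2)
    (hreg : regular G1 gamma1)
    (th : r_orientation G1)
    (lam : 'I_n1 -> R)
    (hlam : char_poly (adj_mx R G1) = \prod_(j < n1) ('X - (lam j)%:P)) :
  (char_poly (adj_mx R (sub_edge_nbhd_corona G2 th)))%:F =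
  'X%:F ^ (m1%:Z - n1%:Z)
  * (char_poly (adj_mx R G2))%:F ^+ m1
  * \prod_(j < n1)
      ('X%:F ^+ 2
       - (1 + 'X%:F * coronal (adj_mx R G2)) * ((lam j + gamma1%:R)%:P)%:F).
Proof.
subst n1 m1.
(* Constants embed by [iota], and the field result is applied with the indeterminate itself as
   [x]. *)
pose iota : {rmorphism R -> {fraction {poly R}}} :=
  (@FracField.tofrac {poly R}) \o (@polyC R).
pose x := 'X%:F : {fraction {poly R}}.
have adjE G : map_mx iota (adj_mx R G) = adj_mx _ G.
  apply/matrixP=> i j; rewrite !mxE; case: ifP => _; last by rewrite rmorph0.
  by rewrite rmorph_int.
have charE G : (char_poly (adj_mx R G))%:F = \det (x%:M - adj_mx _ G).
  rewrite /char_poly -det_map_mx -adjE; congr (\det _).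
  by apply/matrixP=> i j; rewrite !mxE rmorphB rmorphMn.
have x0 : x != 0 by rewrite tofrac_eq0 polyX_eq0.
(* The determinant is the image of a monic polynomial, hence nonzero. *)
have Bu : x%:M - adj_mx _ G2 \in unitmx.
  by rewrite unitmxE unitfE -charE tofrac_eq0 monic_neq0 // char_poly_monic.
have hlamK : char_poly (adj_mx {fraction {poly R}} G1)
    = \prod_j ('X - (iota (lam j))%:P).
  rewrite -adjE -map_char_poly hlam rmorph_prod; apply: eq_bigr => j _.
  by rewrite rmorphB /= map_polyX map_polyC.
rewrite (charE (sub_edge_nbhd_corona G2 th)).
rewrite (det_corona_eigen th hreg x0 Bu hlamK) -charE.
have -> : coronal (adj_mx R G2)
    = ((marking_vec _ G2)^T *m invmx (x%:M - adj_mx _ G2) *m marking_vec _ G2)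
        ord0 ord0 by rewrite /coronal -adjE.
congr (_ * _); apply: eq_bigr => j _.
have -> : ((lam j + gamma1%:R)%:P)%:F = iota (lam j) + gamma1%:R.
  by rewrite -[LHS]/(iota _) rmorphD rmorph_nat.
by [].
Qed.
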